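(* Let $n\ge 3$ and let $\epsilon_1,\epsilon_2,\epsilon_3\in\{0,1\}$. The assignment $\phi_{(\epsilon_1,\epsilon_2,\epsilon_3)}\colon VSG_n\to S_n$ given on generators by $\sigma_i\mapsto (i\ i+1)^{\epsilon_1}$, $\tau_i\mapsto (i\ i+1)^{\epsilon_2}$, $v_i\mapsto (i\ i+1)^{\epsilon_3}$ for $1\le i\le n-1$ is a group homomorphism (i.e. extends to one) if and only if $(\epsilon_1,\epsilon_2,\epsilon_3)$ is one of the following triples: $(0,0,0)$, in which case $\phi_{(0,0,0)}$ is the trivial homomorphism; $(1,1,1)$, in which case $\operatorname{Ker}(\phi_{(1,1,1)})=VSPG_n$; $(1,0,1)$; $(0,0,1)$.
   Context: For $n\ge 2$, $VSG_n$ is the group with generators $\sigma_1,\dots,\sigma_{n-1},\tau_1,\dots,\tau_{n-1},v_1,\dots,v_{n-1}$ and relations (for all admissible indices): $\sigma_i\sigma_j=\sigma_j\sigma_i$, $v_iv_j=v_jv_i$, $\tau_i\tau_j=\tau_j\tau_i$, $\sigma_i\tau_j=\tau_j\sigma_i$, $\sigma_iv_j=v_j\sigma_i$, $\tau_iv_j=v_j\tau_i$ whenever $|i-j|\ge 2$; $v_i^2=1$ and $\sigma_i\tau_i=\tau_i\sigma_i$ for $1\le i\le n-1$; and for $1\le i\le n-2$: $\sigma_i\sigma_{i+1}\sigma_i=\sigma_{i+1}\sigma_i\sigma_{i+1}$, $v_iv_{i+1}v_i=v_{i+1}v_iv_{i+1}$, $\sigma_i\sigma_{i+1}\tau_i=\tau_{i+1}\sigma_i\sigma_{i+1}$,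 $\sigma_{i+1}\sigma_i\tau_{i+1}=\tau_i\sigma_{i+1}\sigma_i$, $v_i\sigma_{i+1}v_i=v_{i+1}\sigma_iv_{i+1}$, $v_i\tau_{i+1}v_i=v_{i+1}\tau_iv_{i+1}$. $S_n$ is the symmetric group on $\{1,\dots,n\}$. $VSPG_n$, the virtual singular pure braid group, is by definition the kernel of the canonical homomorphism $VSG_n\to S_n$ sending each of $\sigma_i,\tau_i,v_i$ to $(i\ i+1)$. *)

(* Defs.v *)
From HB Require Import structures.
From mathcomp Require Import fingroup perm.
From mathcomp Require Import all_boot boolp zify.

Set Implicit Arguments.
Unset Strict Implicit.
Unset Printing Implicit Defensive.

Import GroupScope.
Local Open Scope quotient_scope.

(* The letter (x, false) stands for the generator x, and (x, true) for x^-1. *)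
Definition word (X : Type) : Type := seq (X * bool).

Definition letter_inv (X : Type) (l : X * bool) : X * bool := (l.1, ~~ l.2).

Definition word_inv (X : Type) (w : word X) : word X :=
  rev (map (@letter_inv X) w).

(* The least congruence on words that cancels l l^-1 and identifies the two
   sides of every relation; l^-1 l is cancelled too, as letter_inv is an
   involution. *)
Inductive pres_cong (X : Type) (rels : word X -> word X -> Prop) :
    word X -> word X -> Prop :=
| PresRefl u : pres_cong rels u u
| PresSym u v : pres_cong rels u v -> pres_cong rels v u
| PresTrans u v w :
    pres_cong rels u v -> pres_cong rels v w -> pres_cong rels u w
| PresCat u u' v v' :
    pres_cong rels u u' -> pres_cong rels v v' ->
    pres_cong rels (u ++ v) (u' ++ v')
| PresCancel l : pres_cong rels [:: l; letter_inv l] [::]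
| PresRel u v : rels u v -> pres_cong rels u v.

Definition word_eval (X : Type) (G : groupType) (f : X -> G) (w : word X) : G :=
  foldr (fun l g => (if l.2 then (f l.1)^-1 else f l.1) * g) 1 w.

Section Presented.
Variables (X : choiceType) (rels : word X -> word X -> Prop).

Definition pres_rel : rel (word X) := fun u v => `[< pres_cong rels u v >].

Lemma pres_rel_refl : reflexive pres_rel.
Proof. by move=> u; apply/asboolP; apply: PresRefl. Qed.

Lemma pres_rel_sym : symmetric pres_rel.
Proof. by move=> u v; apply: asbool_equiv_eq; split; apply: PresSym. Qed.

Lemma pres_rel_trans : transitive pres_rel.
Proof.
move=> v u w /asboolP uv /asboolP vw.
by apply/asboolP; apply: PresTrans uv vw.
Qed.

Canonical pres_equiv :=
  EquivRel pres_rel pres_rel_refl pres_rel_sym pres_rel_trans.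

Definition presented : Type := {eq_quot pres_equiv}.

HB.instance Definition _ := Choice.on presented.

Definition pres_class (w : word X) : presented := \pi_presented w.

Lemma pres_classP (u v : word X) :
  pres_class u = pres_class v <-> pres_cong rels u v.
Proof.
split=> [/eqP|uv]; first by rewrite eqmodE => /asboolP.
by apply/eqP; rewrite eqmodE; apply/asboolP.
Qed.

Lemma pres_reprK (x : presented) : pres_class (repr x) = x.
Proof. exact: reprK. Qed.

Lemma pres_repr_class (w : word X) : pres_cong rels (repr (pres_class w)) w.
Proof. by apply/pres_classP; rewrite pres_reprK. Qed.

Lemma pres_ind (P : presented -> Prop) :
  (forall w, P (pres_class w)) -> forall x, P x.
Proof. by move=> Pw x; rewrite -(pres_reprK x). Qed.

Lemma letter_invK : involutive (@letter_inv X).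
Proof. by case=> x b; rewrite /letter_inv negbK. Qed.

Lemma word_invK : involutive (@word_inv X).
Proof.
by move=> w; rewrite /word_inv map_rev revK -map_comp map_id_in // => l _;
  rewrite /= letter_invK.
Qed.

Lemma pres_cong_catV (w : word X) : pres_cong rels (w ++ word_inv w) [::].
Proof.
elim: w => [|l w IHw]; first exact: PresRefl.
have -> : (l :: w) ++ word_inv (l :: w) =
    [:: l] ++ ((w ++ word_inv w) ++ [:: letter_inv l]).
  by rewrite /word_inv /= rev_cons -cats1 catA.
apply: PresTrans (PresCancel rels l).
apply: (@PresCat _ _ _ [:: l] _ ([::] ++ _)); first exact: PresRefl.
by apply: PresCat; last exact: PresRefl.
Qed.

Lemma pres_cong_catVw (w : word X) : pres_cong rels (word_inv w ++ w) [::].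
Proof. by rewrite -{2}[w]word_invK; apply: pres_cong_catV. Qed.

Lemma pres_cong_inv (u v : word X) :
  pres_cong rels u v -> pres_cong rels (word_inv u) (word_inv v).
Proof.
move=> uv; apply: (@PresTrans _ _ _ (word_inv u ++ (v ++ word_inv v))).
  rewrite -{1}[word_inv u]cats0; apply: PresCat; first exact: PresRefl.
  by apply: PresSym; apply: pres_cong_catV.
rewrite catA -{2}[word_inv v]cat0s; apply: PresCat; last exact: PresRefl.
apply: PresTrans (pres_cong_catVw u).
by apply: PresCat; [apply: PresRefl | apply: PresSym].
Qed.

Definition pres_mul (x y : presented) : presented :=
  pres_class (repr x ++ repr y).
Definition pres_one : presented := pres_class [::].
Definition pres_inv (x : presented) : presented :=
  pres_class (word_inv (repr x)).

Lemma pres_mulE u v :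
  pres_mul (pres_class u) (pres_class v) = pres_class (u ++ v).
Proof. by apply/pres_classP; apply: PresCat; apply: pres_repr_class. Qed.

Lemma pres_invE u : pres_inv (pres_class u) = pres_class (word_inv u).
Proof. by apply/pres_classP; apply/pres_cong_inv/pres_repr_class. Qed.

Lemma pres_mulA : associative pres_mul.
Proof.
by do 3![elim/pres_ind=> ?]; rewrite !pres_mulE catA.
Qed.

Lemma pres_mul1 : left_id pres_one pres_mul.
Proof. by elim/pres_ind=> u; rewrite pres_mulE. Qed.

Lemma pres_mulr1 : right_id pres_one pres_mul.
Proof. by elim/pres_ind=> u; rewrite pres_mulE cats0. Qed.

Lemma pres_mulV : left_inverse pres_one pres_inv pres_mul.
Proof.
elim/pres_ind=> u; rewrite pres_invE pres_mulE.
exact/pres_classP/pres_cong_catVw.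
Qed.

Lemma pres_mulrV : right_inverse pres_one pres_inv pres_mul.
Proof.
elim/pres_ind=> u; rewrite pres_invE pres_mulE.
exact/pres_classP/pres_cong_catV.
Qed.

HB.instance Definition _ := isGroup.Build presented
  pres_mulA pres_mul1 pres_mulr1 pres_mulV pres_mulrV.

Definition pres_gen (x : X) : presented := pres_class [:: (x, false)].

Section Lift.
Variables (G : groupType) (f : X -> G).
Hypothesis f_rels : forall u v, rels u v -> word_eval f u = word_eval f v.

Definition pres_lift (x : presented) : G := word_eval f (repr x).

Lemma word_eval_cat (u v : word X) :
  word_eval f (u ++ v) = word_eval f u * word_eval f v.
Proof.
elim: u => [|l u IHu] /=; first by rewrite mul1g.
by rewrite IHu mulgA.
Qed.

Lemma word_eval_cong (u v : word X) :
  pres_cong rels u v -> word_eval f u = word_eval f v.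
Proof.
elim=> {u v} [||||[x b]|] //=.
- by move=> u v w _ -> _ ->.
- by move=> u u' v v' _ eu _ ev; rewrite !word_eval_cat eu ev.
- by case: b; rewrite /= mulg1 ?mulVg ?mulgV.
Qed.

Lemma pres_lift_class (w : word X) :
  pres_lift (pres_class w) = word_eval f w.
Proof. exact/word_eval_cong/pres_repr_class. Qed.

Lemma pres_lift_gen (x : X) : pres_lift (pres_gen x) = f x.
Proof. by rewrite pres_lift_class /= mulg1. Qed.

Lemma pres_liftM : {morph pres_lift : x y / x * y}.
Proof.
elim/pres_ind=> u; elim/pres_ind=> v.
by rewrite [_ * _]pres_mulE !pres_lift_class word_eval_cat.
Qed.

End Lift.
End Presented.

Definition hom_ker (G H : groupType) (f : G -> H) : {pred G} :=
  [pred x | f x == 1].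

(* Indices are shifted by one: i : 'I_n.-1 stands for the index i.+1, and
   'S_n permutes {0, ..., n-1}. *)
Inductive vsg_gen (n : nat) : Type :=
| GSigma of 'I_n.-1
| GTau of 'I_n.-1
| GNu of 'I_n.-1.

Section GenChoice.
Variable n : nat.

Definition vsg_gen_code (g : vsg_gen n) : 'I_n.-1 + ('I_n.-1 + 'I_n.-1) :=
  match g with
  | GSigma i => inl i
  | GTau i => inr (inl i)
  | GNu i => inr (inr i)
  end.

Definition vsg_gen_decode (c : 'I_n.-1 + ('I_n.-1 + 'I_n.-1)) : vsg_gen n :=
  match c with
  | inl i => GSigma i
  | inr (inl i) => GTau i
  | inr (inr i) => GNu i
  end.

Lemma vsg_gen_codeK : cancel vsg_gen_code vsg_gen_decode.
Proof. by case. Qed.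

HB.instance Definition _ := Countable.copy (vsg_gen n) (can_type vsg_gen_codeK).

End GenChoice.

Definition far (m : nat) (i j : 'I_m) : bool := (i.+2 <= j) || (j.+2 <= i).

Section Relations.
Variable n : nat.
Implicit Types i j : 'I_n.-1.

Let s i : vsg_gen n * bool := (GSigma i, false).
Let t i : vsg_gen n * bool := (GTau i, false).
Let v i : vsg_gen n * bool := (GNu i, false).

Inductive vsg_rel : word (vsg_gen n) -> word (vsg_gen n) -> Prop :=
| Far_ss i j : far i j -> vsg_rel [:: s i; s j] [:: s j; s i]
| Far_vv i j : far i j -> vsg_rel [:: v i; v j] [:: v j; v i]
| Far_tt i j : far i j -> vsg_rel [:: t i; t j] [:: t j; t i]
| Far_st i j : far i j -> vsg_rel [:: s i; t j] [:: t j; s i]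
| Far_sv i j : far i j -> vsg_rel [:: s i; v j] [:: v j; s i]
| Far_tv i j : far i j -> vsg_rel [:: t i; v j] [:: v j; t i]
| Sq_v i : vsg_rel [:: v i; v i] [::]
| Comm_st i : vsg_rel [:: s i; t i] [:: t i; s i]
| Braid_sss i j : j = i.+1 :> nat ->
    vsg_rel [:: s i; s j; s i] [:: s j; s i; s j]
| Braid_vvv i j : j = i.+1 :> nat ->
    vsg_rel [:: v i; v j; v i] [:: v j; v i; v j]
| Braid_sst i j : j = i.+1 :> nat ->
    vsg_rel [:: s i; s j; t i] [:: t j; s i; s j]
| Braid_sst' i j : j = i.+1 :> nat ->
    vsg_rel [:: s j; s i; t j] [:: t i; s j; s i]
| Braid_vsv i j : j = i.+1 :> nat ->
    vsg_rel [:: v i; s j; v i] [:: v j; s i; v j]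
| Braid_vtv i j : j = i.+1 :> nat ->
    vsg_rel [:: v i; t j; v i] [:: v j; t i; v j].

End Relations.

Definition VSG (n : nat) : Type := presented (@vsg_rel n).

HB.instance Definition _ (n : nat) := Group.on (VSG n).

Definition vsg_sigma (n : nat) (i : 'I_n.-1) : VSG n := pres_gen _ (GSigma i).
Definition vsg_tau (n : nat) (i : 'I_n.-1) : VSG n := pres_gen _ (GTau i).
Definition vsg_nu (n : nat) (i : 'I_n.-1) : VSG n := pres_gen _ (GNu i).

Lemma adj_lt (n : nat) (i : 'I_n.-1) : i < n.
Proof. exact: leq_trans (ltn_ord i) (leq_pred n). Qed.

Lemma adjS_lt (n : nat) (i : 'I_n.-1) : i.+1 < n.
Proof. by rewrite -ltn_predRL. Qed.

(* The product of 'S_n composes permutations from left to right. Passing to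
   the opposite product changes nothing below: x |-> x^-1 is an isomorphism
   between the two groups that fixes the transpositions. *)
Definition adj_tperm (n : nat) (i : 'I_n.-1) : 'S_n :=
  tperm (Ordinal (adj_lt i)) (Ordinal (adjS_lt i)).

Definition gen_perm (n : nat) (g : vsg_gen n) : 'S_n :=
  match g with
  | GSigma i | GTau i | GNu i => adj_tperm i
  end.

Definition vsg_perm (n : nat) : VSG n -> 'S_n := pres_lift (@gen_perm n).

Lemma adj_tperm_far (n : nat) (i j : 'I_n.-1) : far i j ->
  adj_tperm i * adj_tperm j = adj_tperm j * adj_tperm i.
Proof.
by rewrite /far => ij; rewrite [LHS]conjgC tpermJ !tpermD // -val_eqE /=; lia.
Qed.

Lemma adj_tperm_braid (n : nat) (i j : 'I_n.-1) : j = i.+1 :> nat ->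
  adj_tperm i * adj_tperm j * adj_tperm i =
  adj_tperm j * adj_tperm i * adj_tperm j.
Proof.
move=> ij.
have eij : Ordinal (adj_lt j) = Ordinal (adjS_lt i) by apply: val_inj.
have tJ (x y : 'S_n) : x^-1 = x -> x * y * x = y ^ x.
  by rewrite /conjg mulgA => ->.
rewrite !tJ ?tpermV // /adj_tperm !tpermJ eij tpermL tpermR.
by rewrite !tpermD // -val_eqE /=; lia.
Qed.

Lemma gen_perm_rels (n : nat) (u v : word (vsg_gen n)) :
  vsg_rel u v -> word_eval (@gen_perm n) u = word_eval (@gen_perm n) v.
Proof.
by case=> {u v} [i j|i j|i j|i j|i j|i j|i|//|i j|i j|i j|i j|i j|i j] /=;
  rewrite ?mulg1 ?tperm2 ?mulgA //;
  first [exact: adj_tperm_far | exact: adj_tperm_braid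
        | by move/adj_tperm_braid].
Qed.

Lemma vsg_permM (n : nat) : {morph @vsg_perm n : x y / x * y}.
Proof. exact/pres_liftM/gen_perm_rels. Qed.

HB.instance Definition _ (n : nat) :=
  isMultiplicative.Build (VSG n) 'S_n (@vsg_perm n) (@vsg_permM n).

Lemma vsg_perm_sigma (n : nat) (i : 'I_n.-1) :
  vsg_perm (vsg_sigma i) = adj_tperm i.
Proof. by rewrite /vsg_perm pres_lift_gen //; apply: gen_perm_rels. Qed.

Lemma vsg_perm_tau (n : nat) (i : 'I_n.-1) :
  vsg_perm (vsg_tau i) = adj_tperm i.
Proof. by rewrite /vsg_perm pres_lift_gen //; apply: gen_perm_rels. Qed.

Lemma vsg_perm_nu (n : nat) (i : 'I_n.-1) :
  vsg_perm (vsg_nu i) = adj_tperm i.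
Proof. by rewrite /vsg_perm pres_lift_gen //; apply: gen_perm_rels. Qed.

Definition VSPG (n : nat) : {pred VSG n} := hom_ker (@vsg_perm n).

Arguments VSPG n : clear implicits.

Definition extends_phi (n e1 e2 e3 : nat) (f : VSG n -> 'S_n) : Prop :=
  forall i : 'I_n.-1,
    [/\ f (vsg_sigma i) = adj_tperm i ^+ e1,
        f (vsg_tau i) = adj_tperm i ^+ e2
      & f (vsg_nu i) = adj_tperm i ^+ e3].

(* Main.v *)
Require Import Defs.
From HB Require Import structures.
From mathcomp Require Import fingroup perm.
From mathcomp Require Import all_boot zify.

Set Implicit Arguments.
Unset Strict Implicit.
Unset Printing Implicit Defensive.

(** The four listed assignments satisfy every defining relation. The other
    triples are excluded because (1 2) <> (2 3): if e3 = 0, then the relation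
    v_1 s_2 v_1 = v_2 s_1 v_2 forces e1 = 0, and if e1 = 0, then the relation
    s_1 s_2 t_1 = t_2 s_1 s_2 forces e2 = 0. *)

Section GroupHom.
Local Open Scope group_scope.
Variables (G H : groupType) (phi : {multiplicative G -> H}).

(** A [multiplicative] map is only given to preserve products; the unit follows by cancelling
    [phi 1]. *)
Lemma mulmorph1 : phi 1 = 1.
Proof. by apply: (mulgI (phi 1)); rewrite -gmulfM !mulg1. Qed.

Lemma mulmorphV : {morph phi : x / x^-1}.
Proof.
by move=> x; apply: (mulgI (phi x)); rewrite -gmulfM !mulgV mulmorph1.
Qed.

End GroupHom.

Section PresentedHom.
Local Open Scope group_scope.
Variables (X : choiceType) (rels : word X -> word X -> Prop) (G : groupType).
Variables (f : X -> G) (phi : {multiplicative presented rels -> G}).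
Hypothesis phi_gen : forall x, phi (pres_gen rels x) = f x.

(** A homomorphism is determined by its values on the generators: split off one letter at a time. *)
Lemma hom_pres_class (w : word X) : phi (pres_class rels w) = word_eval f w.
Proof.
elim: w => [|[x b] w IHw] /=; first exact: mulmorph1.
have -> : pres_class rels ((x, b) :: w) =
    pres_class rels [:: (x, b)] * pres_class rels w.
  by rewrite [RHS]pres_mulE.
rewrite gmulfM IHw; congr (_ * _); case: b; last exact: phi_gen.
have -> : pres_class rels [:: (x, true)] = (pres_gen rels x)^-1.
  by rewrite [RHS]pres_invE.
by rewrite mulmorphV phi_gen.
Qed.

(** Both sides of a relation have the same class. This turns each relation into a necessary
    condition on [f]. *)
Lemma hom_word_eval_rels (u v : word X) :
  rels u v -> word_eval f u = word_eval f v.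
Proof.
by move=> uv; rewrite -!hom_pres_class; congr (phi _);
  apply/pres_classP/PresRel.
Qed.

Lemma hom_pres_lift : phi =1 pres_lift f.
Proof. by move=> x; rewrite -{1}(pres_reprK x) hom_pres_class. Qed.

End PresentedHom.

Lemma word_eval1 (X : Type) (G : groupType) (f : X -> G) (w : word X) :
  (forall x, f x = 1%g) -> word_eval f w = 1%g.
Proof.
by move=> f1; elim: w => //= l w ->; rewrite f1 invg1 if_same mulg1.
Qed.

Definition gen_phi (n e1 e2 e3 : nat) (g : vsg_gen n) : 'S_n :=
  match g with
  | GSigma i => (adj_tperm i ^+ e1)%g
  | GTau i => (adj_tperm i ^+ e2)%g
  | GNu i => (adj_tperm i ^+ e3)%g
  end.

Lemma extends_phi_gen (n e1 e2 e3 : nat) (phi : VSG n -> 'S_n) :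
  extends_phi e1 e2 e3 phi ->
  forall g, phi (pres_gen _ g) = gen_phi e1 e2 e3 g.
Proof. by move=> phiE [] i; case: (phiE i). Qed.

Lemma gen_phi_rels (n e1 e2 e3 : nat) (u v : word (vsg_gen n)) :
  (e1, e2, e3) \in [:: (0, 0, 0); (1, 1, 1); (1, 0, 1); (0, 0, 1)] ->
  vsg_rel u v ->
  word_eval (@gen_phi n e1 e2 e3) u = word_eval (@gen_phi n e1 e2 e3) v.
Proof.
rewrite !inE => /or4P[] /eqP[-> -> ->];
  case=> {u v} [i j|i j|i j|i j|i j|i j|i|i|i j|i j|i j|i j|i j|i j] /=;
  rewrite ?expg0 ?expg1 ?mulg1 ?mul1g ?tperm2 ?mulgA //;
  (* Once the exponents are substituted, the relations still open are commutations of distant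
     transpositions or braid relations. *)
  by [move/adj_tperm_far | move/adj_tperm_braid].
Qed.

Lemma adj_tperm_inj (n : nat) : injective (@adj_tperm n).
Proof.
(* Compare images of the point [i]: the left one is [i.+1], and the right one can equal it only if
   [i = j]. *)
move=> i j /perm.permP/(_ (Ordinal (adj_lt i)))/(congr1 val).
rewrite tpermL; case: tpermP => [/(congr1 val) /= ij _|/(congr1 val)|_ _] /=.
- exact: val_inj.
- lia.
- lia.
Qed.

Theorem proposition20 (n e1 e2 e3 : nat) (hn : 3 <= n)
    (he1 : e1 \in [:: 0; 1]) (he2 : e2 \in [:: 0; 1])
    (he3 : e3 \in [:: 0; 1]) :
  [/\ (exists phi : {multiplicative VSG n -> 'S_n},
          extends_phi e1 e2 e3 phi) <->
        (e1, e2, e3) \in [:: (0, 0, 0); (1, 1, 1); (1, 0, 1); (0, 0, 1)],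
      forall phi : {multiplicative VSG n -> 'S_n},
        (e1, e2, e3) = (0, 0, 0) -> extends_phi e1 e2 e3 phi ->
        forall x : VSG n, phi x = 1%g
    & forall phi : {multiplicative VSG n -> 'S_n},
        (e1, e2, e3) = (1, 1, 1) -> extends_phi e1 e2 e3 phi ->
        hom_ker phi =i VSPG n].
Proof.
split.
- split=> [[phi /extends_phi_gen phiE]|e_in].
    (* As [3 <= n], the indices 0 and 1 exist; they stand for 1 and 2. *)
    have lt0 : 0 < n.-1 by case: n hn {phi phiE} => [|[]].
    have lt1 : 1 < n.-1 by case: n hn {phi phiE lt0} => [|[|[]]].
    pose i := Ordinal lt0; pose j := Ordinal lt1.
    have neq_ij : adj_tperm i <> adj_tperm j by move/adj_tperm_inj.
    have := hom_word_eval_rels phiE (@Braid_sst n i j erefl).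
    have := hom_word_eval_rels phiE (@Braid_vsv n i j erefl).
    move: he1 he2 he3; rewrite !inE.
    (* For each of the four unlisted triples, one of the two equations reduces to equality of the
       transpositions at [i] and [j]. *)
    by do 3!case/orP=> /eqP->; rewrite //= ?expg0 ?expg1 !(mul1g, mulg1) // => *;
      case: neq_ij.
  have rels_e := fun u v => @gen_phi_rels n e1 e2 e3 u v e_in.
  pose phiM := isMultiplicative.Build (VSG n) 'S_n
    (pres_lift (@gen_phi n e1 e2 e3)) (pres_liftM rels_e).
  pose phi : {multiplicative VSG n -> 'S_n} := HB.pack (pres_lift _) phiM.
  by exists phi => i; split; apply: (pres_lift_gen rels_e).
- move=> phi [-> -> ->] /extends_phi_gen phiE x.
  by rewrite (hom_pres_lift phiE); apply: word_eval1; case.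
- move=> phi [-> -> ->] /extends_phi_gen phiE x.
  (* Agreeing with [vsg_perm] on generators, [phi] equals it everywhere, so the kernels coincide. *)
  have phi_gen g : phi (pres_gen _ g) = gen_perm g.
    by rewrite phiE; case: g.
  by rewrite !inE (hom_pres_lift phi_gen).
Qed.
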